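(* Let $H$ be a complex Hilbert space and let $A:\mathcal{D}(A)\subset H\to H$ be a closed, densely defined linear operator with compact resolvent and $0\in\varrho(A)$. Let $W$ be a Hilbert space with $\mathcal{D}(A)\subset W\subset H$, continuously and densely embedded into $H$. Suppose that $(P_n,A_n)_{n\in\mathbb{N}}$ approximates $A$ uniformly, and let $$C_0=\sup_{n\in\mathbb{N}}\left(\|A_n^{-1}\|\|P_n\|+6\|A_n^{-1}\|\|P_n\|^2\right).$$ Let $$r>0,\quad 0<\varepsilon<\frac{1}{\|A^{-1}\|}\quad\text{and}\quad \frac{\|A^{-1}\|^2\varepsilon}{1-\|A^{-1}\|\varepsilon}<\delta\le\frac{\|A^{-1}\|^2\varepsilon}{1-\|A^{-1}\|\varepsilon}+\frac72\|A^{-1}\|.$$ If $n_0\in\mathbb{N}$ is chosen such that for every $n\ge n_0$ $$\|A^{-1}-A_n^{-1}P_n\|+(r+\varepsilon)\|A^{-1}\|_{\mathcal{L}(H,W)}\,C_0\,\|I-P_n\|_{\mathcal{L}(W,H)}<\delta-\frac{\|A^{-1}\|^2\varepsilon}{1-\|A^{-1}\|\varepsilon},$$ then $$\sigma_\varepsilon(A)\cap\overline{B_r(0)}\subset\left(B_\delta(W(A_n^{-1}))\right)^{-1}\quad\text{for all } n\ge n_0.$$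
   Context: $\mathcal{L}(X,Y)$ denotes the bounded linear operators from $X$ to $Y$, $\mathcal{L}(X)=\mathcal{L}(X,X)$; $\|\cdot\|$ without subscript is the norm of $H$ or the operator norm on $H$ (or on $U_n$ with the norm of $H$). Under the assumptions, $A^{-1}\in\mathcal{L}(H,W)$ by the closed graph theorem. The family $(P_n,A_n)_{n\in\mathbb{N}}$ approximates $A$ uniformly (with respect to $W$) if: (i) $U_n\subset H$, $n\in\mathbb{N}$, are finite-dimensional subspaces of $H$; (ii) $P_n\in\mathcal{L}(H)$ are projections onto $U_n$, not necessarily orthogonal, with $\sup_n\|P_n\|<\infty$ and $\|(I-P_n)|_W\|_{\mathcal{L}(W,H)}\to0$ as $n\to\infty$; (iii) $A_n\in\mathcal{L}(U_n)$ are invertible operators with $\|A^{-1}-A_n^{-1}P_n\|\to0$ as $n\to\infty$. One writes $\|I-P_n\|_{\mathcal{L}(W,H)}$ for $\|(I-P_n)|_W\|_{\mathcal{L}(W,H)}$. The $\varepsilon$-pseudospectrum is $\sigma_\varepsilon(A)=\sigma(A)\cup\{\lambda\in\varrho(A): \|(A-\lambda)^{-1}\|>\frac1\varepsilon\}$. The numerical range of an operator $T$ is $W(T)=\{\langle Tx,x\rangle: x\in\mathcal{D}(T),\ \|x\|=1\}$ (inner product of $H$; not to be confused with the space $W$). For $U\subset\mathbb{C}$ and $\delta>0$: $B_\delta(U)=\{z\in\mathbb{C}:\operatorname{dist}(z,U)<\delta\}$, $U^{-1}=\{z^{-1}: z\in U\setminus\{0\}\}$; $B_r(0)$ is the open disc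 of radius $r$ around $0$; a bar denotes closure. *)

(* Defs.v *)
From HB Require Import structures.
From mathcomp Require Import all_boot all_order all_algebra.
From mathcomp Require Import all_classical all_reals all_analysis.
From mathcomp Require Import complex.

Set Implicit Arguments.
Unset Strict Implicit.
Unset Printing Implicit Defensive.

Import Order.TTheory GRing.Theory Num.Theory Num.Def.
Import numFieldNormedType.Exports.

Local Open Scope classical_set_scope.
Local Open Scope ring_scope.

(* The inner product is linear in its first argument and conjugate-linear in
   the second. *)
HB.mixin Record NormedModule_isInnerProduct (R : realType) H
    & NormedModule R[i] H := {
  inner : {dot H for @conjC R[i]} ;
  innerxx : forall x : H, inner x x = `|x| ^+ 2
}.

#[short(type="hilbertType")]
HB.structure Definition Hilbert (R : realType) :=
  {H of CompleteNormedModule R[i] H & NormedModule_isInnerProduct R H}.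

(* Norms over R[i] take their values in R[i]; [rnorm] is the same number in R. *)
Definition rnorm (R : realType) (V : normedZmodType R[i]) (x : V) : R :=
  complex.Re `|x|.

(** A linear operator with domain [D], a subspace of [X], is represented by a
    total function [T : X -> Y] whose values outside [D] are irrelevant. *)
Section Operators.
Variables (R : realType) (X Y : normedModType R[i]).
Implicit Types (D : set X) (T : X -> Y).

Definition subspace D : Prop :=
  D 0 /\ forall (a : R[i]) x y, D x -> D y -> D (a *: x + y).

Definition linear_op D T : Prop :=
  subspace D /\ forall (a : R[i]) x y, D x -> D y -> T (a *: x + y) = a *: T x + T y.

Definition bounded_op D T : Prop :=
  exists M : R, forall x, D x -> rnorm (T x) <= M * rnorm x.

(* The real [sup] is the operator norm of bounded operators only. *)
Definition opnorm D T : R :=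
  sup [set rnorm (T x) | x in [set x | D x /\ rnorm x <= 1]].

Definition closed_op D T : Prop :=
  closed [set p : X * Y | D p.1 /\ p.2 = T p.1].

Definition compact_op D T : Prop :=
  precompact [set T x | x in [set x | D x /\ rnorm x <= 1]].

Definition inv_op D T : Y -> X := 'pinv_(fun=> 0) D T.

Definition fin_dim D : Prop :=
  exists (k : nat) (e : 'I_k -> X),
    D = [set \sum_(i < k) c i *: e i | c in [set: 'I_k -> R[i]]].

End Operators.

Section Spectrum.
Variables (R : realType) (H : normedModType R[i]).
Implicit Types (D : set H) (T : H -> H).

Definition resolvent D T (l : R[i]) : H -> H := inv_op D (fun x => T x - l *: x).

Definition resolvent_set D T : set R[i] :=
  [set l | set_bij D [set: H] (fun x => T x - l *: x) /\
           bounded_op [set: H] (resolvent D T l)].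

Definition spectrum D T : set R[i] := ~` resolvent_set D T.

Definition pseudospectrum (eps : R) D T : set R[i] :=
  spectrum D T `|`
  [set l | resolvent_set D T l /\ opnorm [set: H] (resolvent D T l) > 1 / eps].

Definition compact_resolvent D T : Prop :=
  exists l, resolvent_set D T l /\ compact_op [set: H] (resolvent D T l).

End Spectrum.

Definition numerical_range (R : realType) (H : hilbertType R) (D : set H)
    (T : H -> H) : set R[i] :=
  [set inner (T x) x | x in [set x | D x /\ rnorm x = 1]].

Section ComplexSets.
Variable R : realType.
Implicit Types (z : R[i]) (U : set R[i]).

(* Extended real-valued, so that the distance to the empty set is [+oo]. *)
Definition dist z U : \bar R := ereal_inf [set (rnorm (z - u))%:E | u in U].

Definition nbhd (delta : R) U : set R[i] := [set z | (dist z U < delta%:E)%E].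

Definition inv_set U : set R[i] := [set z^-1 | z in U `\ 0].

(* The library's [closed_ball] is the closure of the open ball. *)
Definition closed_disc (r : R) : set R[i] := closed_ball (0 : R[i]^o) r%:C%C.

End ComplexSets.

(** [W] with [D `<=` W `<=` H] is a Hilbert space together with an injective
    linear map [j : W -> H], the inclusion. *)
Definition cont_dense_embedding (R : realType) (W H : hilbertType R)
    (j : {linear W -> H}) : Prop :=
  [/\ injective j, continuous j & dense (range j)].

(* A map [T : X -> H] with range in [range j], viewed as a map [X -> W]. *)
Definition corestrict (X : Type) (R : realType) (W H : hilbertType R)
    (j : {linear W -> H}) (T : X -> H) : X -> W :=
  fun x => inv_op [set: W] j (T x).

Section UniformApproximation.
Variables (R : realType) (H W : hilbertType R) (j : {linear W -> H}).

Definition projection_onto (U : set H) (P : H -> H) : Prop :=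
  range P = U /\ forall x, P (P x) = P x.

(* [T] is an invertible element of the algebra of bounded operators on [U]. *)
Definition invertible_in (U : set H) (T : H -> H) : Prop :=
  [/\ linear_op U T, bounded_op U T, set_bij U U T & bounded_op U (inv_op U T)].

Definition approximates_uniformly (D : set H) (A : H -> H)
    (U : nat -> set H) (P : nat -> {linear H -> H}) (A_ : nat -> H -> H) : Prop :=
  [/\ forall n, fin_dim (U n),
      [/\ forall n, continuous (P n) /\ projection_onto (U n) (P n),
          has_ubound (range (fun n => opnorm [set: H] (P n))) &
          (fun n => opnorm [set: W] (fun w => j w - P n (j w))) @ \oo --> (0 : R)]
    & (forall n, invertible_in (U n) (A_ n)) /\
      (fun n => opnorm [set: H]
         (fun x => inv_op D A x - inv_op (U n) (A_ n) (P n x))) @ \oo --> (0 : R)].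

End UniformApproximation.

(* Main.v *)
(* A point l of the pseudospectrum with |l| <= r has an approximate eigenvector:
   a unit x in D(A) with |(A - l) x| < eps. This includes l in the spectrum: as
   A^-1 is a norm limit of finite rank operators, I - l A^-1 is surjective as
   soon as it is bounded below. Hence 1/l is within
   c = |A^-1|^2 eps / (1 - |A^-1| eps) of <A^-1 x, x>. Put u = P_n x and
   eta = (r + eps) |A^-1|_{H,W} |I - P_n|_{W,H}, so that |x - u| <= eta.
   Replacing <A^-1 x, x> by <A_n^-1 u, x> costs |A^-1 - A_n^-1 P_n|, and passing
   to the point <A_n^-1 u, u> / |u|^2 of the numerical range costs
   |A_n^-1| (2 |P_n| + 1) eta <= C0 eta, provided that u <> 0. The upper bound on
   delta ensures this: letting n tend to infinity gives C0 >= 7 |A^-1|, so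
   eta < 1/2. The boundedness of A^-1 : H -> W is the closed graph theorem. *)
Require Import Defs.
From mathcomp Require Import all_boot all_order all_algebra.
From mathcomp Require Import all_classical all_reals all_analysis.
From mathcomp Require Import complex.
From mathcomp Require Import ring lra.

Import Order.TTheory GRing.Theory Num.Theory.
Import numFieldNormedType.Exports.

Local Open Scope classical_set_scope.
Local Open Scope ring_scope.

Set Implicit Arguments.
Unset Strict Implicit.

(** * The real-valued norm, with its rules transferred from the [R[i]]-valued one *)

Section RealNorm.
Variables (R : realType) (V : normedModType R[i]).
Implicit Types (x y : V) (z : R[i]).

Lemma rnormE (W : normedZmodType R[i]) (x : W) : `|x| = (rnorm x)%:C%C.
Proof. by rewrite /rnorm RRe_real// normr_real. Qed.

Lemma rnorm_ge0 (W : normedZmodType R[i]) (x : W) : 0 <= rnorm x.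
Proof. by rewrite -ler0c -rnormE. Qed.

Lemma rnorm_eq0 (W : normedZmodType R[i]) (x : W) : rnorm x = 0 -> x = 0.
Proof. by move=> x0; apply/eqP; rewrite -normr_eq0 rnormE x0. Qed.

Lemma rnorm0 (W : normedZmodType R[i]) : rnorm (0 : W) = 0.
Proof. by rewrite /rnorm normr0. Qed.

Lemma rnorm_gt0 (W : normedZmodType R[i]) (x : W) : x <> 0 -> 0 < rnorm x.
Proof.
move=> x0; rewrite lt_neqAle rnorm_ge0 andbT eq_sym.
by apply/eqP => /rnorm_eq0.
Qed.

Lemma rnormD (W : normedZmodType R[i]) (x y : W) :
  rnorm (x + y) <= rnorm x + rnorm y.
Proof. by rewrite -lecR rmorphD /= -!rnormE ler_normD. Qed.

Lemma rnormN (W : normedZmodType R[i]) (x : W) : rnorm (- x) = rnorm x.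
Proof. by rewrite /rnorm normrN. Qed.

Lemma rnormB (W : normedZmodType R[i]) (x y : W) :
  rnorm (x - y) <= rnorm x + rnorm y.
Proof. by rewrite -(rnormN y) rnormD. Qed.

Lemma rdistC (W : normedZmodType R[i]) (x y : W) :
  rnorm (x - y) = rnorm (y - x).
Proof. by rewrite -rnormN opprB. Qed.

Lemma rdist_triangle (W : normedZmodType R[i]) (x y z : W) :
  rnorm (x - z) <= rnorm (x - y) + rnorm (y - z).
Proof. by rewrite (le_trans _ (rnormD _ _))// addrA subrK. Qed.

Lemma lerB_rnorm (W : normedZmodType R[i]) (x y : W) :
  rnorm x - rnorm y <= rnorm (x - y).
Proof. by rewrite lerBlDr (le_trans _ (rnormD _ _))// subrK. Qed.

Lemma rnormZ z x : rnorm (z *: x) = rnorm z * rnorm x.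
Proof. by apply: complexI; rewrite rmorphM /= -!rnormE normrZ. Qed.

Lemma rnormM z1 z2 : rnorm (z1 * z2) = rnorm z1 * rnorm z2.
Proof. by apply: complexI; rewrite rmorphM /= -!rnormE normrM. Qed.

Lemma rnormV z : rnorm z^-1 = (rnorm z)^-1.
Proof. by apply: complexI; rewrite fmorphV /= -!rnormE normfV. Qed.

Lemma rnorm_real (a : R) : rnorm a%:C%C = `|a|.
Proof. by rewrite /rnorm normc_def /= expr0n /= addr0 sqrtr_sqr. Qed.

End RealNorm.

(** * Linear and bounded operators, the operator norm, inverses *)

Section Operators.
Variables (R : realType) (X Y : normedModType R[i]).
Implicit Types (D : set X) (T : X -> Y).

Lemma linear_op_setT (f : {linear X -> Y}) : linear_op [set: X] f.
Proof. by split=> [|a x y _ _]; [split | rewrite linearP]. Qed.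

Lemma linear_opB D T x y : linear_op D T -> D x -> D y ->
  D (x - y) /\ T (x - y) = T x - T y.
Proof.
move=> [[_ DP] TP] Dx Dy.
rewrite [x - y]addrC [T x - _]addrC -(scaleN1r y) -(scaleN1r (T y)); split; first exact: DP.
exact: TP.
Qed.

Lemma linear_op0 D T : linear_op D T -> T 0 = 0.
Proof.
by move=> DT; have [[D0 _] _] := DT; have [_] := linear_opB DT D0 D0; rewrite !subrr.
Qed.

Lemma linear_opZ D T a x : linear_op D T -> D x ->
  D (a *: x) /\ T (a *: x) = a *: T x.
Proof.
move=> lT Dx; have [[D0 DP] TP] := lT; split.
  by rewrite -[_ *: _]addr0; exact: DP.
by rewrite -[a *: x]addr0 TP// (linear_op0 lT) addr0.
Qed.

Lemma linear_opD D T x y : linear_op D T -> D x -> D y ->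
  D (x + y) /\ T (x + y) = T x + T y.
Proof.
move=> [[_ DP] TP] Dx Dy; split; first by rewrite -[x]scale1r; exact: DP.
by rewrite -{1}[x]scale1r TP// scale1r.
Qed.

Lemma bounded_op_pos D T : bounded_op D T ->
  exists2 M, 0 < M & forall x, D x -> rnorm (T x) <= M * rnorm x.
Proof.
move=> [M TM]; exists (Num.max M 1); first by rewrite lt_max ltr01 orbT.
move=> x /TM/le_trans; apply; rewrite ler_wpM2r ?rnorm_ge0//.
by rewrite le_max lexx.
Qed.

Lemma opnorm_has_sup D T : D 0 -> bounded_op D T ->
  has_sup [set rnorm (T x) | x in [set x | D x /\ rnorm x <= 1]].
Proof.
move=> D0 /bounded_op_pos[M M0 TM]; split.
  by exists (rnorm (T 0)), 0 => //=; rewrite rnorm0.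
exists M => _ /= [x [Dx x1] <-]; apply: (le_trans (TM _ Dx)).
by rewrite ger_pMr.
Qed.

Lemma opnorm_ge0 D T : D 0 -> bounded_op D T -> 0 <= opnorm D T.
Proof.
move=> D0 bT; apply: (le_trans (rnorm_ge0 (T 0))).
have [_ ub] := opnorm_has_sup D0 bT; apply: ub_le_sup => //.
by exists 0 => //=; rewrite rnorm0.
Qed.

Lemma opnorm_le D T M : D 0 ->
  (forall x, D x -> rnorm x <= 1 -> rnorm (T x) <= M) -> opnorm D T <= M.
Proof.
move=> D0 TM; apply: ge_sup; last by move=> _ /= [x [Dx x1] <-]; exact: TM.
by exists (rnorm (T 0)), 0 => //=; rewrite rnorm0.
Qed.

Lemma ler_opnorm D T x : linear_op D T -> bounded_op D T -> D x ->
  rnorm (T x) <= opnorm D T * rnorm x.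
Proof.
move=> lT bT Dx; have [[D0 _] _] := lT.
have [->|/eqP/rnorm_gt0 x0] := eqVneq x 0.
  by rewrite (linear_op0 lT) !rnorm0 mulr0.
rewrite -ler_pdivrMr//.
have [Dy Ty] := linear_opZ ((rnorm x)^-1)%:C%C lT Dx.
have xV : rnorm (((rnorm x)^-1)%:C%C : R[i]) = (rnorm x)^-1.
  by rewrite rnorm_real ger0_norm// invr_ge0 ltW.
have [_ ub] := opnorm_has_sup D0 bT; apply: ub_le_sup => //=.
exists (((rnorm x)^-1)%:C%C *: x) => /=.
  by split=> //; rewrite rnormZ xV mulVf// gt_eqF.
by rewrite Ty rnormZ xV mulrC.
Qed.

Lemma continuous_bounded_op (f : {linear X -> Y}) :
  continuous f -> bounded_op [set: X] f.
Proof.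
move=> /(linear_bounded_continuous f)/(linear_boundedP f)/pinfty_ex_gt0[M M0 fM].
exists (complex.Re M) => x _; rewrite -lecR rmorphM /= -!rnormE RRe_real//.
exact: gtr0_real.
Qed.

Section Inverse.
Variables (D : set X) (E : set Y) (T : X -> Y).
Hypothesis bijT : set_bij D E T.

Lemma inv_opK x : D x -> inv_op D T (T x) = x.
Proof. by have [_ Tinj _] := bijT => Dx; apply: pinvKV => //; rewrite inE. Qed.

Lemma inv_op_dom y : E y -> D (inv_op D T y).
Proof.
by have [_ _ Tsurj] := bijT => /Tsurj[x Dx <-]; rewrite inv_opK.
Qed.

Lemma inv_opKV y : E y -> T (inv_op D T y) = y.
Proof.
by have [_ _ Tsurj] := bijT => /Tsurj[x Dx <-]; rewrite inv_opK.
Qed.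

Lemma linear_inv_op : linear_op D T ->
  forall a x y, E x -> E y -> inv_op D T (a *: x + y) = a *: inv_op D T x + inv_op D T y.
Proof.
move=> [[_ DP] TP] a x y Ex Ey.
have [Dx Dy] := (inv_op_dom Ex, inv_op_dom Ey).
by rewrite -{1}(inv_opKV Ex) -{1}(inv_opKV Ey) -TP// inv_opK//; exact: DP.
Qed.

End Inverse.

End Operators.

(** * The Cauchy-Schwarz inequality *)

Section Inner.
Variables (R : realType) (H : hilbertType R).
Implicit Types x y : H.

Lemma inner_xx x : inner x x = (rnorm x ^+ 2)%:C%C.
Proof. by rewrite innerxx rnormE rmorphXn. Qed.

Lemma cauchy_schwarz x y : rnorm (inner x y) <= rnorm x * rnorm y.
Proof.
have [->|/eqP/rnorm_gt0 y0] := eqVneq y 0.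
  by rewrite linear0r rnorm0 mulr_ge0 ?rnorm_ge0.
(* The vector [c *: x - b *: y] is |y|^2 times the component of x orthogonal to y. Its squared norm
   is |y|^2 (|x|^2 |y|^2 - |b|^2), which is nonnegative. *)
pose b := inner x y; pose c : R[i] := (rnorm y ^+ 2)%:C%C.
have dE : inner (c *: x) (b *: y) = (rnorm y ^+ 2 * rnorm b ^+ 2)%:C%C.
  rewrite linearZl_LR linearZr_LR /= -/b [RHS]rmorphM /= -/c; congr (_ * _).
  by rewrite rmorphXn /= -rnormE normCK mulrC.
have := dnorm_ge0 (@inner _ H) (c *: x - b *: y).
rewrite (dnormB (@inner _ H) (c *: x)) !dnormZ /= dE !inner_xx !rnormE.
rewrite rnorm_real ger0_norm ?sqr_ge0// conj_Creal; last first.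
  by apply/complex_realP; eexists.
rewrite -!rmorphXn -!rmorphM -!rmorphD -rmorphB /= ler0c => h.
rewrite -ler_sqr ?nnegrE ?mulr_ge0 ?rnorm_ge0//.
rewrite -(ler_pM2l (exprn_gt0 2 y0)) exprMn -/b; nra.
Qed.

End Inner.

(** * Completeness: geometric convergence, successive approximation, closed graph theorem *)

Section Completeness.
Variable R : realType.

Lemma geometric_lt (C q e : R) : 0 < q < 1 -> 0 < e -> exists n, C * q ^+ n < e.
Proof.
move=> /andP[q0 q1] e0.
have /cvgrPdist_lt : C * q ^+ n @[n --> \oo] --> (0 : R).
  rewrite -[X in _ --> X](mulr0 C); apply: cvgMr.
  by apply: cvg_expr; rewrite gtr0_norm.
move=> /(_ _ e0)[n _ /(_ n (leqnn n))]; rewrite /= sub0r normrN => h.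
by exists n; exact: le_lt_trans (ler_norm _) h.
Qed.

Lemma geometric_cvg (V : completeNormedModType R[i]) (x : nat -> V) (C q : R) :
  0 < q < 1 -> (forall n, rnorm (x n.+1 - x n) <= C * q ^+ n) ->
  exists l, forall n, rnorm (l - x n) <= C / (1 - q) * q ^+ n.
Proof.
move=> q01 xC; have /andP[q0 q1] := q01.
have p0 : 0 < 1 - q by rewrite subr_gt0.
have C0 : 0 <= C by have := xC 0%N; rewrite expr0 mulr1; exact/le_trans/rnorm_ge0.
have K0 : 0 <= C / (1 - q) by rewrite divr_ge0// ltW.
have xle n k : rnorm (x (n + k)%N - x n) <= C / (1 - q) * q ^+ n.
  (* The sharper bound with q^n - q^(n+k) telescopes, so that the induction on k goes through. *)
  apply: (@le_trans _ _ (C / (1 - q) * (q ^+ n - q ^+ (n + k)))); last first.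
    by rewrite ler_wpM2l// gerBl exprn_ge0// ltW.
  elim: k => [|k IHk]; first by rewrite addn0 !subrr rnorm0 mulr0.
  apply: (le_trans (rdist_triangle _ (x (n + k)%N) _)).
  rewrite addnS; apply: (le_trans (lerD (xC _) IHk)); rewrite exprSr.
  by rewrite le_eqVlt; apply/predU1P; left; field; rewrite gt_eqF.
have : cvg (x @ \oo).
  apply/cauchy_cvgP/cauchy_exP => e e0.
  have eE : e = (complex.Re e)%:C%C by rewrite RRe_real// gtr0_real.
  have {}e0 : 0 < complex.Re e by rewrite -ltcR -eE.
  have [n xn] := geometric_lt (C / (1 - q)) q01 e0.
  exists (x n), n => // m /= nm.
  rewrite -ball_normE /= rnormE eE ltcR rdistC.
  by apply: le_lt_trans xn; rewrite -(subnKC nm).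
move=> /cvg_ex[l xl]; exists l => n; apply/ler_addgt0Pr => e e0.
have eC0 : 0 < (e%:C%C : R[i]) by rewrite ltcR.
have [m _ /(_ (n + m)%N (leq_addl _ _))] := (cvgrPdist_lt _ _).1 xl _ eC0.
rewrite /= rnormE ltcR => lm.
apply: (le_trans (rdist_triangle _ (x (n + m)%N) _)).
by rewrite addrC lerD// ltW.
Qed.

(** The iteration from the proof of the open mapping theorem: each remainder is again solved up to
    half its norm, and the corrections sum to a solution of norm at most C (1 + 1/2 + 1/4 + ...)
    |y|. With [f] = j and [g] = j o T it yields the closed graph theorem, with [g] = id a
    surjectivity criterion. *)
Lemma approx_solve (X Y : completeNormedModType R[i]) (Z : normedModType R[i])
    (f : X -> Z) (g : Y -> Z) (C : R) :
  linear_op setT f -> bounded_op setT f -> linear_op setT g -> bounded_op setT g ->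
  (forall y, exists x y', [/\ f x = g y', rnorm x <= C * rnorm y &
     rnorm (y - y') <= rnorm y / 2]) ->
  forall y, exists2 x, f x = g y & rnorm x <= 2 * C * rnorm y.
Proof.
move=> lf /bounded_op_pos[Mf Mf0 fM] lg /bounded_op_pos[Mg Mg0 gM] fg y.
have /choice[F FP] : forall y, exists p : X * Y, [/\ f p.1 = g p.2,
    rnorm p.1 <= C * rnorm y & rnorm (y - p.2) <= rnorm y / 2].
  by move=> y'; have [x' [y'' ?]] := fg y'; exists (x', y'').
(* [r n] is the remainder after n corrections and [x n] their sum. *)
pose r := fix r n := if n is n'.+1 then r n' - (F (r n')).2 else y.
pose x := fix x n := if n is n'.+1 then x n' + (F (r n')).1 else 0.
have fx n : f (x n) = g (y - r n).
  elim: n => [|n IHn] /=; first by rewrite subrr (linear_op0 lf) (linear_op0 lg).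
  have [_ ->] := linear_opD (x := x n) (y := (F (r n)).1) lf I I.
  rewrite opprB addrA addrAC IHn; have [-> _ _] := FP (r n).
  by have [_ ->] := linear_opD (x := y - r n) (y := (F (r n)).2) lg I I.
have rn n : rnorm (r n) <= rnorm y * 2^-1 ^+ n.
  elim: n => [|n IHn]; first by rewrite expr0 mulr1.
  have [_ _ /le_trans] := FP (r n); apply.
  by rewrite exprSr mulrA ler_wpM2r// invr_ge0.
(* A nonzero y forces C >= 0, since C |y| bounds a norm; y = 0 is solved by 0. *)
have C0 : 0 <= C \/ y = 0.
  have [/eqP|/eqP/rnorm_gt0 y0] := eqVneq y 0; first by move/eqP; right.
  left; have [_ h _] := FP y.
  by rewrite -(pmulr_lge0 _ y0) (le_trans _ h)// rnorm_ge0.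
case: C0 => [C0|->]; last by exists 0; rewrite ?(linear_op0 lf) ?(linear_op0 lg)// !rnorm0 mulr0.
have h01 : 0 < (2^-1 : R) < 1 by apply/andP; split; lra.
have [] := @geometric_cvg _ x (C * rnorm y) _ h01.
  move=> n /=; rewrite addrAC subrr add0r -mulrA; have [_ + _] := FP (r n).
  by move=> /le_trans; apply; rewrite ler_wpM2l.
move=> l xl; exists l; last first.
  have := xl 0%N; rewrite subr0 expr0 mulr1 => /le_trans; apply.
  by rewrite le_eqVlt; apply/predU1P; left; field; lra.
(* Passing to the limit: |f l - g y| is at most |f (l - x n)| + |g (r n)|, which is below a fixed
   multiple of 2^-n for every n. *)
apply/eqP; rewrite -subr_eq0; apply/eqP/rnorm_eq0/eqP.
rewrite eq_le rnorm_ge0 andbT leNgt; apply/negP => d0.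
have [n] := geometric_lt (Mf * (C * rnorm y / (1 - 2^-1)) + Mg * rnorm y) h01 d0.
apply/negP; rewrite -leNgt.
apply: (le_trans (rdist_triangle _ (f (x n)) _)); rewrite mulrDl; apply: lerD.
  have [_ <-] := linear_opB (x := l) (y := x n) lf I I.
  by apply: (le_trans (fM _ I)); rewrite -[leRHS]mulrA ler_pM2l.
rewrite fx.
have [_ <-] := linear_opB (x := y - r n) (y := y) lg I I.
rewrite addrAC subrr add0r.
by apply: (le_trans (gM _ I)); rewrite rnormN -[leRHS]mulrA ler_pM2l.
Qed.

End Completeness.

(** A closed graph theorem by a gliding hump. It suffices that each y lies within |y|/2 of some x
    with |T x| <= C |y|: then [approx_solve] gives w with j w = j (T y) and |w| <= 2 C |y|, and w =
    T y by injectivity. *)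
Lemma bounded_lift (R : realType) (X Y : completeNormedModType R[i])
    (Z : normedModType R[i]) (j : Y -> Z) (T : X -> Y) : injective j ->
  linear_op setT j -> bounded_op setT j ->
  linear_op setT (j \o T) -> bounded_op setT (j \o T) -> bounded_op setT T.
Proof.
move=> jinj lj bj lg bg.
have lT : linear_op setT T.
  split=> [|a x y _ _]; first by split.
  apply: jinj; have [_ jP] := lj; have [_ gP] := lg.
  by rewrite jP// -[LHS]/((j \o T) _) gP.
suff [C TC] : exists C : R, forall y, exists x,
    rnorm (T x) <= C * rnorm y /\ rnorm (y - x) <= rnorm y / 2.
  exists (2 * C) => y _.
  have [|w /jinj <-//] := @approx_solve _ _ _ _ j (j \o T) C lj bj lg bg _ y.
  by move=> y'; have [x [Tx yx]] := TC y'; exists (T x), x.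
apply: contrapT => /forallNP noC.
pose rho n : R := 4^-1 ^+ n.
(* Otherwise the steps [+- 4^-n e_n], with signs chosen to stay away from the
   sublevel sets of [T], lead to a point at which [T] is infinite. *)
have /choice[F FP] : forall p : nat * X, exists z : X, rnorm (z - p.2) <= rho p.1 /\
    forall x, rnorm (T x) <= p.1%:R -> rho p.1 / 2 < rnorm (z - x).
  move=> [n z] /=; have rho0 : 0 < rho n by rewrite exprn_gt0.
  (* No x within |y|/2 of this y satisfies |T x| <= (n / rho n) |y|; [e] is y rescaled to norm
     [rho n]. *)
  have /existsNP[y /forallNP yP] := noC (n%:R / rho n).
  have y0 : 0 < rnorm y.
    apply: rnorm_gt0 => y0; apply: (yP 0).
    by rewrite (linear_op0 lT) subr0 y0 !rnorm0 mulr0 mul0r.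
  pose t : R := rho n / rnorm y; pose e := t%:C%C *: y.
  have t0 : 0 < t by rewrite divr_gt0.
  have ne : rnorm e = rho n by rewrite rnormZ rnorm_real gtr0_norm// divfK ?gt_eqF.
  have [zP|/existsNP[x1 /not_implyP[Tx1 /negP]]] :=
    pselect (forall x, rnorm (T x) <= n%:R -> rho n / 2 < rnorm (z + e - x)).
    by exists (z + e); rewrite addrAC subrr add0r ne.
  rewrite -leNgt => zx1.
  have [zP|/existsNP[x2 /not_implyP[Tx2 /negP]]] :=
    pselect (forall x, rnorm (T x) <= n%:R -> rho n / 2 < rnorm (z - e - x)).
    by exists (z - e); rewrite addrAC subrr add0r rnormN ne.
  rewrite -leNgt => zx2; exfalso.
  (* If z + e and z - e were within rho n / 2 of points x1 and x2 of the sublevel set, then s (x1 -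
     x2) would approximate s (2 e) = y to within s rho n = |y|/2, with |T (s (x1 - x2))| <= 2 s n =
     (n / rho n) |y|, against the choice of y. *)
  pose s : R := (2 * t)^-1; have s0 : 0 < s by rewrite invr_gt0 mulr_gt0.
  have ns : rnorm (s%:C%C : R[i]) = s by rewrite rnorm_real gtr0_norm.
  have [_ TB] := linear_opB (x := x1) (y := x2) lT I I.
  have [_ TZ] := linear_opZ (x := x1 - x2) s%:C%C lT I.
  apply: (yP (s%:C%C *: (x1 - x2))); split.
    rewrite TZ TB rnormZ ns; apply: (@le_trans _ _ (s * (n%:R + n%:R))).
      by rewrite ler_pM2l// (le_trans (rnormB _ _))// lerD.
    by rewrite le_eqVlt; apply/predU1P; left; rewrite /s /t; field; rewrite !gt_eqF.
  have sr : s * rho n = rnorm y / 2 by rewrite /s /t; field; rewrite !gt_eqF.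
  have yE : y = s%:C%C *: (e + e).
    rewrite /e -scalerDl scalerA -rmorphD -rmorphM /= (_ : _ * _ = 1) ?scale1r//.
    by rewrite /s; field; rewrite gt_eqF.
  rewrite {1}yE -scalerBr rnormZ ns -sr ler_pM2l//.
  have -> : e + e - (x1 - x2) = (z + e - x1) - (z - e - x2).
    by rewrite !opprD !opprK; rewrite [RHS](AC (3*3) (1*4*(2*5)*(3*6)))/= subrr add0r.
  apply: (le_trans (rnormB _ _)); apply: (le_trans (lerD zx1 zx2)).
  by rewrite -splitr.
pose z := fix z n := if n is n'.+1 then F (n', z n') else 0.
have q01 : 0 < (4^-1 : R) < 1 by apply/andP; split; lra.
have [|l lz] := @geometric_cvg _ _ z 1 _ q01.
  by move=> n; rewrite mul1r; have [] := FP (n, z n).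
have [n Tn] : exists n : nat, rnorm (T l) <= n%:R.
  by exists (Num.bound (rnorm (T l))); rewrite ltW// archi_boundP// rnorm_ge0.
(* The limit lies within 4^-(n+1) / (1 - 1/4) = rho n / 3 of [z n.+1], less than the distance rho n
   / 2 kept from the points with |T x| <= n. *)
have [_ /(_ l Tn)] := FP (n, z n); apply/negP; rewrite -leNgt -[F _]/(z n.+1) rdistC.
apply: (le_trans (lz _)); rewrite exprSr /= -/(rho n).
have : 0 < rho n by rewrite exprn_gt0.
rewrite (_ : 1 - 4^-1 = 3 / 4 :> R) ?invf_div ?mul1r; last by lra.
by move: (rho n) => u; rewrite /=; lra.
Qed.

(** * Linear algebra in finite-dimensional subspaces *)

Lemma linear_op_sum (R : realType) (X Y : normedModType R[i]) (D : set X)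
    (T : X -> Y) (m : nat) (c : 'I_m -> R[i]) (z : 'I_m -> X) :
  linear_op D T -> (forall i, D (z i)) ->
  D (\sum_i c i *: z i) /\ T (\sum_i c i *: z i) = \sum_i c i *: T (z i).
Proof.
move=> lT Dz; have [[D0 DP] TP] := lT.
elim: m c z Dz => [|m IHm] c z Dz; first by rewrite !big_ord0 (linear_op0 lT).
rewrite !big_ord_recl.
have [Ds Ts] := IHm (c \o lift ord0) (z \o lift ord0) (fun i => Dz (lift ord0 i)).
by split; [exact: DP | rewrite TP//; congr (_ + _)].
Qed.

Lemma fin_dim_subspace (R : realType) (X : normedModType R[i]) (U : set X) :
  fin_dim U -> Defs.subspace U.
Proof.
move=> [k [e ->]]; split.
  by exists (fun=> 0) => //; rewrite big1// => i _; rewrite scale0r.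
move=> a _ _ [c _ <-] [d _ <-]; exists (fun i => a * c i + d i) => //.
rewrite scaler_sumr -big_split; apply: eq_bigr => i _ /=.
by rewrite scalerDl scalerA.
Qed.

Section FiniteDimension.
Variables (R : realType) (X : normedModType R[i]).
Variables (U : set X) (T : X -> X).
Hypotheses (lT : linear_op U T) (UT : forall x, U x -> U (T x)).

Lemma dependent_iter y : fin_dim U -> U y -> exists k (v : 'I_k -> R[i]),
  (exists i, v i != 0) /\ \sum_i v i *: iter i T y = 0.
Proof.
move=> [k [e UE]] Uy.
have Uiter i : U (iter i T y) by elim: i => //= i; exact: UT.
have /choice[c cP] : forall i, exists c : 'I_k -> R[i],
    \sum_j c j *: e j = iter i T y.
  by move=> i; have := Uiter i; rewrite UE => -[c _ <-]; exists c.
(* The coordinates of k + 1 iterates form a matrix of rank at most k, so its left kernel contains a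
   nonzero row, the required relation. *)
pose M := \matrix_(i < k.+1, j < k) c i j.
have : kermx M != 0.
  rewrite -mxrank_eq0 mxrank_ker subn_eq0 -ltnNge.
  by rewrite (leq_ltn_trans (rank_leq_col M)).
move=> /rowV0Pn[v /sub_kermxP vM v0].
exists k.+1, (v 0); split; first exact/rV0Pn.
under eq_bigr do rewrite -cP scaler_sumr.
rewrite exchange_big big1// => j _.
under eq_bigr do rewrite scalerA.
rewrite -scaler_suml (_ : \sum_(i < k.+1) _ = 0) ?scale0r//.
transitivity ((v *m M) 0 j); last by rewrite vM mxE.
by rewrite mxE; apply: eq_bigr => i _; rewrite mxE.
Qed.

(** The vectors y, T y, T^2 y, ... satisfy a nontrivial relation. Injectivity cancels powers of T
    until y itself has a nonzero coefficient, and then y is T of a combination of iterates. Thus a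
    spanning family is enough and no basis has to be extracted. *)
Lemma fin_dim_inj_surj : fin_dim U -> (forall x, U x -> T x = 0 -> x = 0) ->
  forall y, U y -> exists2 x, U x & T x = y.
Proof.
move=> fdU injT y Uy.
have Uiter i : U (iter i T y) by elim: i => //= i; exact: UT.
have [k [v [[i v0] vT]]] := dependent_iter fdU Uy.
elim: k v i v0 vT => [|k IHk] v i v0; first by case: i v0.
pose s := \sum_(i < k) v (lift ord0 i) *: iter i T y.
have [Us Ts] := @linear_op_sum _ _ _ _ _ k (v \o lift ord0) (fun i => iter i T y) lT
  (fun i => Uiter i).
rewrite big_ord_recl /= -[X in _ + X]Ts -/s => sT.
(* The relation reads v_0 y + T s = 0. If v_0 = 0, then s = 0 is a shorter nontrivial relation;
   otherwise y = T (- s / v_0). *)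
have [v00|v00] := eqVneq (v ord0) 0.
  move: sT; rewrite v00 scale0r add0r => /(injT _ Us); rewrite /s.
  have [j ij|ij] := unliftP ord0 i; last by move: v0; rewrite ij v00 eqxx.
  by apply: (IHk (v \o lift ord0) j); rewrite /= -ij.
have [Ux Tx] := linear_opZ (- (v ord0)^-1) lT Us.
exists (- (v ord0)^-1 *: s) => //; rewrite Tx.
have -> : T s = - (v ord0 *: y) by apply/eqP; rewrite -addr_eq0 addrC sT.
by rewrite scaleNr scalerN opprK scalerA mulVf// scale1r.
Qed.

End FiniteDimension.

(** * The Fredholm alternative for norm limits of finite-rank operators *)

Definition finite_rank_approx (R : realType) (X : normedModType R[i])
    (K : X -> X) := forall e : R, 0 < e -> exists (U : set X) (F : X -> X),
  [/\ fin_dim U, linear_op setT F, forall x, U (F x) &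
      forall x, rnorm (K x - F x) <= e * rnorm x].

Lemma linear_op_id_sub (R : realType) (X : normedModType R[i]) (K : X -> X)
    (l : R[i]) :
  linear_op setT K -> linear_op setT (fun x => x - l *: K x).
Proof.
move=> [sT KP]; split=> // a x y _ _; rewrite KP// [l *: _]scalerDr scalerA.
by rewrite opprD scalerBr scalerA [l * a]mulrC addrACA.
Qed.

(** For F of finite rank close to K, I - l F is still bounded below, hence bijective on the
    finite-dimensional U, which contains the range of F. This makes it onto the whole space, and its
    exact solutions are approximate solutions for I - l K, to which [approx_solve] applies. *)
Lemma bounded_below_surj (R : realType) (X : completeNormedModType R[i])
    (K : X -> X) (l : R[i]) (b : R) :
  linear_op setT K -> bounded_op setT K -> finite_rank_approx K ->
  0 < b -> (forall x, b * rnorm x <= rnorm (x - l *: K x)) ->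
  forall y, exists x, x - l *: K x = y.
Proof.
move=> lK bK aK b0 Kb.
have l1 : 0 < rnorm l + 1 by rewrite ltr_wpDl ?rnorm_ge0.
(* This accuracy gives |l (K - F) x| <= (b/4) |x|; adding 1 to |l| covers l = 0. *)
have e0 : 0 < b / (4 * (rnorm l + 1)) by rewrite divr_gt0// mulr_gt0.
have [U [F [fdU lF UF KF]]] := aK _ e0.
have {}KF x : rnorm (l *: (K x - F x)) <= b / 4 * rnorm x.
  rewrite rnormZ; apply: (le_trans (ler_wpM2l (rnorm_ge0 _) (KF x))).
  rewrite mulrA ler_wpM2r ?rnorm_ge0//.
  rewrite [leLHS](_ : _ = rnorm l / (rnorm l + 1) * (b / 4)).
    by rewrite ler_piMl ?divr_ge0 ?ltW// ltr_pdivrMr// mul1r ltrDl.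
  by field; rewrite gt_eqF.
have FK x : x - l *: F x = (x - l *: K x) + l *: (K x - F x).
  by rewrite scalerBr addrA subrK.
have Fb x : 3 / 4 * b * rnorm x <= rnorm (x - l *: F x).
  rewrite FK -[X in _ + X]opprK; apply: le_trans (lerB_rnorm _ _).
  by rewrite rnormN; have := Kb x; have := KF x; lra.
have lS := linear_op_id_sub l lF.
have subU := fin_dim_subspace fdU.
have Ssurj y : exists x, x - l *: F x = y.
  have lSU : linear_op U (fun x => x - l *: F x).
    by split=> // a x x' _ _; have [_ ->] := lS.
  have [||u Uu uy] := @fin_dim_inj_surj _ _ _ _ lSU _ fdU _ (F y) (UF y).
  - by move=> x Ux; have [_ UP] := subU; rewrite addrC -scaleNr; exact: UP.
  - move=> x _ x0; apply: rnorm_eq0; apply/eqP; rewrite eq_le rnorm_ge0 andbT.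
    have := Fb x; rewrite x0 rnorm0 pmulr_rle0//; last by lra.
  (* Since u - l F u = F y, the vector x = y + l u has F x = u, and so x - l F x = y. *)
  exists (y + l *: u).
  have [_ ->] := linear_opD (x := y) (y := l *: u) lF I I.
  have [_ ->] := linear_opZ (x := u) l lF I.
  by rewrite -uy subrK addrK.
pose f x := x - l *: K x.
have lf : linear_op setT f by exact: linear_op_id_sub.
have bf : bounded_op setT f.
  have [M _ KM] := bounded_op_pos bK.
  exists (1 + rnorm l * M) => x _; apply: (le_trans (rnormB _ _)).
  by rewrite mulrDl mul1r lerD2l rnormZ -mulrA ler_wpM2l ?rnorm_ge0// KM.
have lid : linear_op [set: X] id by split; first by split.
have bid : bounded_op [set: X] id by exists 1 => x _; rewrite mul1r.
move=> y; have [|x <- _] := @approx_solve _ _ _ _ f id (4 / (3 * b)) lf bf lid bid _ y.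
  move=> y'; have [x xy] := Ssurj y'; exists x, (f x); split=> //.
    rewrite -ler_pdivrMl; last by rewrite divr_gt0// mulr_gt0.
    have := Fb x; rewrite xy; apply: le_trans; rewrite invf_div.
    by rewrite le_eqVlt; apply/predU1P; left; field.
  (* The remainder is l (K - F) x, of norm at most (b/4) |x|, while |y'| >= (3/4) b |x|. *)
  rewrite -xy FK addrAC subrr add0r -/(f x) -FK.
  have bx : 0 <= b * rnorm x by rewrite mulr_ge0 ?rnorm_ge0// ltW.
  by apply: (le_trans (KF x)); have := Fb x; lra.
by exists x.
Qed.

(** * Approximate eigenvectors for points of the pseudospectrum *)

Section Pseudospectrum.
Variables (R : realType) (H : completeNormedModType R[i]).
Variables (D : set H) (A : H -> H).
Hypotheses (lA : linear_op D A) (A0 : resolvent_set D A 0).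

Lemma resolvent_set0 : set_bij D setT A /\ bounded_op setT (inv_op D A).
Proof.
move: A0; rewrite /resolvent_set /resolvent /=.
by under [fun x => A x - _]eq_fun do rewrite scale0r subr0.
Qed.

Lemma linear_op_inv0 : linear_op setT (inv_op D A).
Proof.
have [bA _] := resolvent_set0.
by split=> [|a x y _ _]; [split | exact: (linear_inv_op bA)].
Qed.

(** By contraposition: if A - l is bounded below by eps on D, then I - l A^-1 is bounded below,
    hence onto, so l is in the resolvent set with resolvent norm at most 1/eps. *)
Lemma pseudospectrum_approx_eigen (eps : R) (l : R[i]) :
  finite_rank_approx (inv_op D A) -> 0 < eps -> pseudospectrum eps D A l ->
  exists2 x, D x & rnorm (A x - l *: x) < eps * rnorm x.
Proof.
move=> aK eps0 Al; apply: contrapT => nx.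
have Ab x : D x -> eps * rnorm x <= rnorm (A x - l *: x).
  by move=> Dx; rewrite leNgt; apply/negP => Ax; apply: nx; exists x.
have [bA bK] := resolvent_set0; have lK := linear_op_inv0.
have el : 0 < eps + rnorm l by rewrite ltr_wpDr ?rnorm_ge0.
(* With x = A^-1 z, combine |z| <= |z - l x| + |l| |x| and eps |x| <= |z - l x|. *)
have Kb z : eps / (eps + rnorm l) * rnorm z <= rnorm (z - l *: inv_op D A z).
  rewrite mulrAC ler_pdivrMr// mulrC.
  have := Ab _ (inv_op_dom bA (I : setT z)); rewrite (inv_opKV bA)// => Kz.
  have := rnormD (z - l *: inv_op D A z) (l *: inv_op D A z); rewrite subrK rnormZ => zz.
  have := ler_wpM2l (rnorm_ge0 l) Kz; have := ler_wpM2l (ltW eps0) zz; lra.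
have surj := bounded_below_surj lK bK aK (divr_gt0 eps0 el) Kb.
have bAl : set_bij D setT (fun x => A x - l *: x).
  split=> // [x y|y _].
    rewrite !inE => Dx Dy xy; apply/eqP; rewrite -subr_eq0; apply/eqP/rnorm_eq0/eqP.
    have [Dxy Axy] := linear_opB lA Dx Dy.
    rewrite eq_le rnorm_ge0 andbT -(pmulr_rle0 _ eps0).
    apply: (le_trans (Ab _ Dxy)); rewrite Axy scalerBr opprB.
    rewrite [l *: y - _]addrC addrACA xy -[X in _ + X]opprK opprD opprK subrr.
    by rewrite rnorm0.
  have [z zy] := surj y; exists (inv_op D A z); first exact: (inv_op_dom bA).
  by rewrite (inv_opKV bA).
have Rb y : rnorm (resolvent D A l y) <= 1 / eps * rnorm y.
  rewrite mul1r ler_pdivlMl//; apply: (le_trans (Ab _ (inv_op_dom bAl (I : setT y)))).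
  by rewrite (inv_opKV bAl).
have Rl : resolvent_set D A l by split=> //; exists (1 / eps) => y _.
case: Al => [/(_ Rl)//|[_]]; apply/negP; rewrite -leNgt.
apply: opnorm_le => // y _ y1; apply: (le_trans (Rb y)).
by rewrite ler_piMr// divr_ge0// ltW.
Qed.

End Pseudospectrum.

Lemma closed_discP (R : realType) (r : R) (l : R[i]) :
  closed_disc r l -> rnorm l <= r.
Proof.
move=> lr; rewrite leNgt; apply/negP => rl.
have e0 : 0 < ((rnorm l - r)%:C%C : R[i]) by rewrite ltcR subr_gt0.
have [z []] := lr _ (nbhsx_ballx (l : R[i]^o) _ e0).
rewrite -!ball_normE /= sub0r normrN !rnormE !ltcR => zr lz.
have := lerB_rnorm l z; lra.
Qed.

(** * Estimates for points of the numerical range *)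

Section NumericalRange.
Variables (R : realType) (H : hilbertType R).

(** From l K x = x - K y one gets 1/l - <K x, x> = <K y, x> / l, and taking norms gives |l| |K| >= 1
    - |K| eps, which bounds 1/|l|. *)
Lemma inverse_approx_eigenvalue (K : H -> H) (l : R[i]) (x y : H) (eps : R) :
  linear_op setT K -> bounded_op setT K ->
  rnorm x = 1 -> K (l *: x + y) = x -> rnorm y <= eps -> opnorm setT K * eps < 1 ->
  l != 0 /\ rnorm (l^-1 - inner (K x) x) <=
    opnorm setT K ^+ 2 * eps / (1 - opnorm setT K * eps).
Proof.
move=> lK bK x1 Kx ye ke.
have k0 : 0 <= opnorm setT K by exact: opnorm_ge0.
have Kxn := ler_opnorm (x := x) lK bK I; rewrite x1 mulr1 in Kxn.
have Kyn : rnorm (K y) <= opnorm setT K * eps.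
  by apply: (le_trans (ler_opnorm lK bK I)); rewrite ler_wpM2l.
have {Kx} xE : l *: K x = x - K y.
  by have [_ KP] := lK; rewrite -[X in X - _]Kx KP// addrK.
have lk : 1 - opnorm setT K * eps <= rnorm l * opnorm setT K.
  apply: (@le_trans _ _ (rnorm (l *: K x))); last first.
    by rewrite rnormZ ler_wpM2l// rnorm_ge0.
  by rewrite xE; apply: le_trans (lerB_rnorm _ _); rewrite x1; lra.
have l0 : l != 0.
  by apply/eqP => l0; move: lk; rewrite l0 rnorm0 mul0r; lra.
split=> //; have nl0 : 0 < rnorm l by exact/rnorm_gt0/eqP.
have -> : l^-1 - inner (K x) x = l^-1 * inner (K y) x.
  have -> : K x = l^-1 *: (x - K y) by rewrite -xE scalerA mulVf// scale1r.
  rewrite linearZl_LR linearBl /= inner_xx x1 expr1n mulrBr.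
  by rewrite mulr1 opprB addrCA subrr addr0.
rewrite rnormM rnormV ler_pdivlMr; last by lra.
rewrite -mulrA ler_pdivrMl//.
have := cauchy_schwarz (K y) x; rewrite x1 mulr1 => Kyx.
have {Kyx Kyn} := le_trans Kyx Kyn => Kyx.
have := ler_pM (rnorm_ge0 _) (ltW (_ : 0 < 1 - opnorm setT K * eps)) Kyx lk.
rewrite subr_gt0 => /(_ ke)/le_trans; apply.
by rewrite le_eqVlt; apply/predU1P; left; ring.
Qed.

(** Replacing x by u in the second argument costs a p eta. Normalizing u, nonzero because eta < 1,
    costs a ||u|^2 - 1| <= a (p + 1) eta, as ||u| - 1| <= eta. *)
Lemma normalized_form_approx (U : set H) (T : H -> H) (x u : H) (a p eta : R) :
  linear_op U T -> U u -> (forall z, U z -> rnorm (T z) <= a * rnorm z) ->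
  rnorm x = 1 -> rnorm (x - u) <= eta -> eta < 1 -> rnorm u <= p ->
  exists2 v, U v /\ rnorm v = 1 &
    rnorm (inner (T u) x - inner (T v) v) <= a * (2 * p + 1) * eta.
Proof.
move=> lT Uu Ta x1 xu eta1 up.
have xu1 := lerB_rnorm x u; have ux1 := lerB_rnorm u x.
rewrite rdistC in ux1; rewrite x1 in xu1 ux1.
have u0 : 0 < rnorm u by lra.
have [Uv Tv] := linear_opZ ((rnorm u)^-1)%:C%C lT Uu.
have nV : rnorm (((rnorm u)^-1)%:C%C : R[i]) = (rnorm u)^-1.
  by rewrite rnorm_real ger0_norm// invr_ge0 ltW.
exists (((rnorm u)^-1)%:C%C *: u).
  by split=> //; rewrite rnormZ nV mulVf// gt_eqF.
have a0 : 0 <= a.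
  by rewrite -(pmulr_lge0 _ u0); exact/le_trans/Ta/Uu/rnorm_ge0.
have Tun := Ta _ Uu.
apply: (le_trans (rdist_triangle _ (inner (T u) u) _)).
have -> : a * (2 * p + 1) * eta = a * p * eta + a * (p + 1) * eta by ring.
apply: lerD.
  rewrite -linearBr /=; apply: (le_trans (cauchy_schwarz _ _)).
  apply: ler_pM; rewrite ?rnorm_ge0//.
  by apply: (le_trans Tun); rewrite ler_wpM2l.
rewrite Tv linearZl_LR linearZr_LR /= mulrA.
rewrite -[X in X - _]mul1r -mulrBl rnormM.
have -> : ((rnorm u)^-1)%:C%C * (((rnorm u)^-1)%:C%C)^*%C = ((rnorm u ^+ 2)^-1)%:C%C.
  by rewrite conjc_real -rmorphM -invfM.
have -> : 1 - ((rnorm u ^+ 2)^-1)%:C%C = (1 - (rnorm u ^+ 2)^-1)%:C%C :> R[i].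
  by rewrite rmorphB.
rewrite rnorm_real.
have Tuu : rnorm (inner (T u) u) <= a * rnorm u ^+ 2.
  apply: (le_trans (cauchy_schwarz _ _)); rewrite expr2 mulrA.
  by rewrite ler_wpM2r// rnorm_ge0.
apply: (le_trans (ler_wpM2l (normr_ge0 _) Tuu)).
have -> : `|1 - (rnorm u ^+ 2)^-1| * (a * rnorm u ^+ 2) = a * `|rnorm u ^+ 2 - 1|.
  rewrite mulrCA; congr (a * _).
  rewrite -[X in _ * X = _]ger0_norm ?sqr_ge0// -normrM mulrBl mul1r mulVf//.
  by rewrite expf_eq0 gt_eqF.
rewrite -mulrA ler_wpM2l// -[X in _ - X](expr1n _ 2) subr_sqr normrM mulrC.
rewrite ler_pM//; first by rewrite ger0_norm; lra.
by rewrite ler_norml; apply/andP; split; lra.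
Qed.

End NumericalRange.

(** * Differences and compositions of operators *)

Section OperatorAlgebra.
Variables (R : realType) (X Y Z : normedModType R[i]).

Lemma linear_op_sub (D : set X) (f g : X -> Y) :
  linear_op D f -> linear_op D g -> linear_op D (fun x => f x - g x).
Proof.
move=> [DS fP] [_ gP]; split=> // a x y Dx Dy.
by rewrite fP// gP// scalerBr opprD addrACA.
Qed.

Lemma bounded_op_sub (D : set X) (f g : X -> Y) :
  bounded_op D f -> bounded_op D g -> bounded_op D (fun x => f x - g x).
Proof.
move=> [M fM] [N gN]; exists (M + N) => x Dx.
by rewrite mulrDl (le_trans (rnormB _ _))// lerD// ?fM ?gN.
Qed.

Lemma linear_op_comp (D : set X) (E : set Y) (f : X -> Y) (g : Y -> Z) :
  (forall x, D x -> E (f x)) -> linear_op D f -> linear_op E g ->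
  linear_op D (fun x => g (f x)).
Proof.
move=> fE [DS fP] [_ gP]; split=> // a x y Dx Dy.
by rewrite fP// gP//; exact: fE.
Qed.

Lemma bounded_op_comp (D : set X) (E : set Y) (f : X -> Y) (g : Y -> Z) :
  (forall x, D x -> E (f x)) -> bounded_op D f -> bounded_op E g ->
  bounded_op D (fun x => g (f x)).
Proof.
move=> fE [M fM] /bounded_op_pos[N N0 gN]; exists (N * M) => x Dx.
by apply: (le_trans (gN _ (fE _ Dx))); rewrite -mulrA ler_pM2l// fM.
Qed.

End OperatorAlgebra.

(** * Operators into the embedded space W *)

Section Embedding.
Variables (R : realType) (H W : hilbertType R) (j : {linear W -> H}).
Hypothesis hj : cont_dense_embedding j.

Lemma corestrictK (X : Type) (T : X -> H) x :
  range j (T x) -> j (corestrict j T x) = T x.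
Proof. by move=> Tx; rewrite /corestrict/inv_op pinvK ?inE. Qed.

(** Composing the corestriction with j gives back T, so [bounded_lift] applies. Hence the norm of
    A^-1 from H to W is a genuine supremum. *)
Lemma bounded_corestrict (T : H -> H) : linear_op setT T -> bounded_op setT T ->
  (forall x, range j (T x)) ->
  linear_op setT (corestrict j T) /\ bounded_op setT (corestrict j T).
Proof.
move=> lT bT Tj; have [jinj jcont _] := hj.
have lj := linear_op_setT j; have bj := continuous_bounded_op jcont.
have jT : j \o corestrict j T = T by apply/funext => x; exact: corestrictK.
split; last by apply: (@bounded_lift _ _ _ _ j) => //; rewrite jT.
split=> [|a x y _ _]; first by split.
apply: jinj; rewrite linearP !corestrictK//.
by have [_ ->] := lT.
Qed.

End Embedding.

(** * Consequences of uniform approximation, and bounds for C0 *)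

Section Approximation.
Variables (R : realType) (H W : hilbertType R) (j : {linear W -> H}).
Variables (D : set H) (A : H -> H) (U : nat -> set H) (P : nat -> {linear H -> H}).
Variable A_ : nat -> H -> H.
Hypotheses (lA : linear_op D A) (A0 : resolvent_set D A 0).
Hypothesis happrox : approximates_uniformly j D A U P A_.

Let K := inv_op D A.
Let F n := inv_op (U n) (A_ n).
Let p n := opnorm setT (P n).
Let a n := opnorm (U n) (F n).
Let E n x := K x - F n (P n x).
Let d n := opnorm setT (E n).

Lemma projectionU n x : U n (P n x).
Proof. by have [_ [/(_ n)[_ [<- _]] _ _] _] := happrox; exists x. Qed.

Lemma projection_id n x : U n x -> P n x = x.
Proof.
have [_ [/(_ n)[_ [<- PP]] _ _] _] := happrox.
by move=> [y _ <-].
Qed.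

Lemma bounded_projection n : bounded_op setT (P n).
Proof.
by have [_ [/(_ n)[Pc _] _ _] _] := happrox; exact: continuous_bounded_op.
Qed.

Lemma approx_inv_linear n : linear_op (U n) (F n).
Proof.
have [_ _ [/(_ n)[lAn _ bAn _] _]] := happrox.
by have [sU _] := lAn; split=> // b x y; exact: (linear_inv_op bAn).
Qed.

Lemma approx_inv_bounded n : bounded_op (U n) (F n).
Proof. by have [_ _ [/(_ n)[]]] := happrox. Qed.

Lemma approx_inv_dom n x : U n x -> U n (F n x).
Proof. by have [_ _ [/(_ n)[_ _ bAn _] _]] := happrox; exact: (inv_op_dom bAn). Qed.

Lemma approx_error_linear n : linear_op setT (E n).
Proof.
apply: linear_op_sub; first exact: linear_op_inv0.
exact: (linear_op_comp (fun x _ => projectionU n x) (linear_op_setT (P n))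
  (approx_inv_linear n)).
Qed.

Lemma approx_error_bounded n : bounded_op setT (E n).
Proof.
apply: bounded_op_sub; first by have [] := resolvent_set0 A0.
exact: (bounded_op_comp (fun x _ => projectionU n x) (bounded_projection n)
  (approx_inv_bounded n)).
Qed.

Lemma ler_approx_error n x : rnorm (K x - F n (P n x)) <= d n * rnorm x.
Proof. exact: (ler_opnorm (approx_error_linear n) (approx_error_bounded n) I). Qed.

Lemma ler_projection n x : rnorm (P n x) <= p n * rnorm x.
Proof. exact: (ler_opnorm (linear_op_setT (P n)) (bounded_projection n) I). Qed.

Lemma ler_approx_inv n x : U n x -> rnorm (F n x) <= a n * rnorm x.
Proof. exact: (ler_opnorm (approx_inv_linear n) (approx_inv_bounded n)). Qed.

Lemma opnorm_projection_ge0 n : 0 <= p n.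
Proof. exact: opnorm_ge0 (bounded_projection n). Qed.

Lemma opnorm_approx_inv_ge0 n : 0 <= a n.
Proof.
have [[[U0 _] _] bF] := (approx_inv_linear n, approx_inv_bounded n).
exact: opnorm_ge0 bF.
Qed.

Lemma approx_error_cvg0 : d n @[n --> \oo] --> 0.
Proof. by have [_ _ []] := happrox. Qed.

Lemma approx_error_lt e : 0 < e -> exists n, d n < e.
Proof.
move=> e0; have [n _ /(_ n (leqnn n))] := (cvgrPdist_lt _ _).1 approx_error_cvg0 _ e0.
by rewrite /= sub0r normrN => h; exists n; exact: le_lt_trans (ler_norm _) h.
Qed.

(** The operators A_n^-1 P_n have range in U_n and converge to A^-1 in norm. *)
Lemma finite_rank_inv : finite_rank_approx K.
Proof.
move=> e e0; have [n dn] := approx_error_lt e0.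
exists (U n), (fun x => F n (P n x)); split.
- by have [] := happrox.
- exact: (linear_op_comp (fun x _ => projectionU n x) (linear_op_setT (P n))
    (approx_inv_linear n)).
- by move=> x; exact/approx_inv_dom/projectionU.
- move=> x; apply: (le_trans (ler_approx_error n x)).
  by rewrite ler_wpM2r ?rnorm_ge0// ltW.
Qed.

Lemma opnorm_projection_ge1 n x : P n x <> 0 -> 1 <= p n.
Proof.
move=> /rnorm_gt0 Px; rewrite -(ler_pM2r Px) mul1r.
by rewrite -{1}(projection_id (projectionU n x)) ler_projection.
Qed.

Let C n := a n * p n + 6 * a n * p n ^+ 2.

(** On U_n, A_n^-1 = A_n^-1 P_n = K - E_n, so |A_n^-1| is bounded by |K| plus a bound for the
    errors. This makes C0 a genuine supremum. *)
Lemma has_ubound_const : has_ubound (range C).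
Proof.
have [_ [_ [Mp pM] _] _] := happrox.
(* [Md] is a threshold: only numbers strictly above it are known to bound the errors, hence [Md + 1]
   below. *)
have [Md [_ dM]] := cvg_seq_bounded (cvgP _ approx_error_cvg0).
pose k := opnorm setT K.
have aM n : a n <= k + (Md + 1).
  have [[U0 _] _] := approx_inv_linear n.
  apply: opnorm_le => // x Ux x1.
  rewrite -[x in F n x](projection_id Ux).
  rewrite -[F _ _](subKr (K x)); apply: (le_trans (rnormB _ _)); apply: lerD.
    have [_ bK] := resolvent_set0 A0.
    apply: (le_trans (ler_opnorm (linear_op_inv0 lA A0) bK I)).
    by rewrite ler_piMr//; exact: opnorm_ge0 bK.
  apply: (le_trans (ler_approx_error n x)).
  have := dM (Md + 1); rewrite ltrDl ltr01 => /(_ isT n I) /(le_trans (ler_norm _)).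
  by apply: le_trans; rewrite ler_piMr//; exact/opnorm_ge0/approx_error_bounded.
have pM' n : p n <= Mp by apply: pM; exists n.
exists ((k + (Md + 1)) * Mp + 6 * (k + (Md + 1)) * Mp ^+ 2) => _ [n _ <-].
have a0 := opnorm_approx_inv_ge0 n; have p0 := opnorm_projection_ge0 n.
apply: lerD; first exact: ler_pM.
apply: ler_pM => //; rewrite ?mulr_ge0 ?exprn_ge0//; first by rewrite ler_pM2l.
by rewrite lerXn2r// nnegrE// (le_trans p0).
Qed.

(** As |K| <= d_n + a_n p_n and p_n >= 1, the n-th term is at least (1 + 6) a_n p_n >= 7 (|K| -
    d_n), with d_n as small as desired. *)
Lemma sup_const_ge : 0 < opnorm setT K -> 7 * opnorm setT K <= sup (range C).
Proof.
set k := opnorm setT K => k0.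
have kC e : 0 < e < k -> 7 * (k - e) <= sup (range C).
  move=> /andP[e0 ek]; have [n dn] := approx_error_lt e0.
  have p0 := opnorm_projection_ge0 n; have a0 := opnorm_approx_inv_ge0 n.
  have kap : k <= d n + a n * p n.
    apply: opnorm_le => // x _ x1.
    rewrite -[K x](subrK (F n (P n x))); apply: (le_trans (rnormD _ _)); apply: lerD.
      apply: (le_trans (ler_approx_error n x)); rewrite ler_piMr//.
      exact/opnorm_ge0/approx_error_bounded.
    apply: (le_trans (ler_approx_inv (projectionU n x))); rewrite ler_wpM2l//.
    by apply: (le_trans (ler_projection n x)); rewrite ler_piMr.
  (* If P_n vanished, the previous bound would read k <= d_n < e < k. *)
  have p1 : 1 <= p n.
    have [[x /opnorm_projection_ge1//]|nP] := pselect (exists x, P n x <> 0).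
    have : p n <= 0.
      apply: opnorm_le => // x _ _; rewrite (_ : P n x = 0) ?rnorm0//.
      by apply: contrapT => Px; apply: nP; exists x.
    move=> pn0; have pE : p n = 0 by apply/eqP; rewrite eq_le pn0.
    by move: kap; rewrite pE mulr0; lra.
  have : C n <= sup (range C) by apply: ub_le_sup; [exact: has_ubound_const | exists n].
  apply: le_trans; rewrite /C expr2.
  have : a n * p n <= a n * p n * p n by rewrite ler_peMr// mulr_ge0.
  by rewrite -!mulrA; lra.
apply/ler_addgt0Pr => e e0; pose e' := Num.min (e / 7) (k / 2).
have e'0 : 0 < e' by rewrite lt_min !divr_gt0.
have e'k : e' < k by rewrite gt_min; apply/orP; right; lra.
have := kC e'; rewrite e'0 e'k => /(_ isT).
have : e' <= e / 7 by rewrite ge_min lexx.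
lra.
Qed.

End Approximation.

(** * Enclosure of the pseudospectrum by numerical ranges of A_n^-1 *)

Theorem proposition4p8 (R : realType) (H : hilbertType R)
  (D : set H) (A : H -> H)
  (hA_lin : linear_op D A) (hA_closed : closed_op D A) (hA_dense : dense D)
  (hA_compact : compact_resolvent D A) (hA_0 : resolvent_set D A 0)
  (W : hilbertType R) (j : {linear W -> H})
  (hj : cont_dense_embedding j) (hDW : D `<=` range j)
  (U : nat -> set H) (P : nat -> {linear H -> H}) (A_ : nat -> H -> H)
  (happrox : approximates_uniformly j D A U P A_)
  (r eps delta : R) :
  let normAinv := opnorm [set: H] (inv_op D A) in
  let normAinv_HW := opnorm [set: H] (corestrict j (inv_op D A)) in
  let normAninv n := opnorm (U n) (inv_op (U n) (A_ n)) in
  let normP n := opnorm [set: H] (P n) in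
  let C0 := sup (range (fun n =>
    normAninv n * normP n + 6 * normAninv n * normP n ^+ 2)) in
  let c := normAinv ^+ 2 * eps / (1 - normAinv * eps) in
  0 < r ->
  0 < eps < 1 / normAinv ->
  c < delta <= c + 7 / 2 * normAinv ->
  forall n0 : nat,
  (forall n, (n0 <= n)%N ->
    opnorm [set: H] (fun x => inv_op D A x - inv_op (U n) (A_ n) (P n x))
    + (r + eps) * normAinv_HW * C0
      * opnorm [set: W] (fun w => j w - P n (j w)) < delta - c) ->
  forall n, (n0 <= n)%N ->
    pseudospectrum eps D A `&` closed_disc r `<=`
    inv_set (nbhd delta (numerical_range (U n) (inv_op (U n) (A_ n)))).
Proof.
set K := inv_op D A.
move=> k w a p C0 c r0 /andP[eps0 epsk] /andP[cdelta deltac] n0 hn n /hn {hn}.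
set d := opnorm _ _; set q := opnorm _ _ => hd l [Al /closed_discP lr].
set F := inv_op (U n) (A_ n).
have lK : linear_op setT K := linear_op_inv0 hA_lin hA_0.
have [bA bK] := resolvent_set0 hA_0.
have k0 : 0 < k.
  rewrite lt_neqAle eq_sym (opnorm_ge0 _ bK)// andbT.
  (* For k = 0 the convention 1/0 = 0 would give eps < 0. *)
  by apply/eqP => k0; move: epsk; rewrite k0 invr0 mulr0 ltNge ltW.
have keps : k * eps < 1 by rewrite mulrC -ltr_pdivlMr.
have [x [Dx x1 Ax]] : exists x, [/\ D x, rnorm x = 1 & rnorm (A x - l *: x) < eps].
  have [x0 Dx0 Ax0] := pseudospectrum_approx_eigen hA_lin hA_0
    (finite_rank_inv hA_lin hA_0 happrox) eps0 Al.
  have x0n : 0 < rnorm x0.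
    by rewrite -(pmulr_rgt0 _ eps0) (le_lt_trans _ Ax0)// rnorm_ge0.
  have [Dx Ax] := linear_opZ ((rnorm x0)^-1)%:C%C hA_lin Dx0.
  have nV : rnorm (((rnorm x0)^-1)%:C%C : R[i]) = (rnorm x0)^-1.
    by rewrite rnorm_real ger0_norm// invr_ge0 ltW.
  exists (((rnorm x0)^-1)%:C%C *: x0); split=> //.
    by rewrite rnormZ nV mulVf// gt_eqF.
  rewrite Ax scalerA [l * _]mulrC -scalerA -scalerBr rnormZ nV.
  by rewrite ltr_pdivrMl// mulrC.
pose y := A x - l *: x.
have Kx : K (l *: x + y) = x by rewrite /y addrC subrK; exact: (inv_opK bA).
have [l0 cx] := inverse_approx_eigenvalue lK bK x1 Kx (ltW Ax) keps.
have [lw bw] := bounded_corestrict hj lK bK (fun z => hDW _ (inv_op_dom bA (I : setT z))).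
pose Q := fun v : W => j v - P n (j v).
have [_ jcont _] := hj.
have lj := linear_op_setT j; have bj := continuous_bounded_op jcont.
have lQ : linear_op setT Q.
  by apply: linear_op_sub => //; exact: linear_op_comp lj (linear_op_setT (P n)).
have bQ : bounded_op setT Q.
  apply: bounded_op_sub => //.
  exact: bounded_op_comp bj (bounded_projection happrox n).
have q0 : 0 <= q by exact: opnorm_ge0 bQ.
have w0 : 0 <= w by exact: opnorm_ge0 bw.
pose eta := (r + eps) * w * q.
have eta0 : 0 <= eta by rewrite !mulr_ge0// addr_ge0// ltW.
have xPx : rnorm (x - P n x) <= eta.
  (* Here x = A^-1 (A x) is viewed in W, and |A x| <= |l| + eps <= r + eps. *)
  have xE : j (corestrict j K (A x)) = x.
    rewrite corestrictK; last exact: hDW (inv_op_dom bA (I : setT (A x))).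
    exact: (inv_opK bA).
  rewrite -{1 2}xE -/(Q _); apply: (le_trans (ler_opnorm lQ bQ I)).
  rewrite mulrC ler_wpM2r//; apply: (le_trans (ler_opnorm lw bw I)).
  rewrite mulrC ler_wpM2r//.
  rewrite -[A x](subrK (l *: x)) addrC; apply: (le_trans (rnormD _ _)).
  by rewrite rnormZ x1 mulr1 lerD// ltW.
have C7 := sup_const_ge hA_lin hA_0 happrox k0.
rewrite -/K -/k -/C0 in C7.
have d0 : 0 <= d by exact: opnorm_ge0 (approx_error_bounded hA_0 happrox n).
have etaC : d + eta * C0 < delta - c by move: hd; rewrite /eta mulrAC.
have eta1 : eta < 1.
  have : eta * (7 * k) <= eta * C0 by rewrite ler_wpM2l.
  have : eta * C0 < 7 / 2 * k by lra.
  move=> h1 /le_lt_trans/(_ h1); rewrite mulrA (ltr_pM2r k0); lra.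
have Px0 : P n x <> 0.
  by move=> Px0; move: xPx; rewrite Px0 subr0 x1 leNgt eta1.
have p1 := opnorm_projection_ge1 happrox Px0; rewrite -/(p n) in p1.
have Pxp : rnorm (P n x) <= p n.
  by have := ler_projection happrox n x; rewrite x1 mulr1.
have a0 : 0 <= a n := opnorm_approx_inv_ge0 happrox n.
have [v [Uv v1] vF] := normalized_form_approx (approx_inv_linear happrox n)
  (projectionU happrox n x) (@ler_approx_inv _ _ _ _ _ _ _ _ _ happrox n) x1 xPx eta1 Pxp.
(* Since p_n >= 1, 2 p_n + 1 <= 3 p_n <= p_n + 6 p_n^2. *)
have CC : a n * (2 * p n + 1) <= C0.
  have : a n * p n + 6 * a n * p n ^+ 2 <= C0.
    by apply: ub_le_sup; [exact: (has_ubound_const hA_lin hA_0 happrox) | exists n].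
  apply: le_trans.
  have : a n * 1 <= a n * p n by rewrite ler_wpM2l.
  have : a n * p n <= a n * p n * p n by rewrite ler_peMr// mulr_ge0// (le_trans ler01).
  rewrite expr2; nra.
exists l^-1; last by rewrite invrK.
split; last by apply/eqP; rewrite invr_eq0.
rewrite /nbhd /=.
apply: (@le_lt_trans _ _ (rnorm (l^-1 - inner (F v) v))%:E).
  by apply: ereal_inf_lbound; exists (inner (F v) v) => //; exists v.
rewrite lte_fin.
have KF : rnorm (inner (K x) x - inner (F (P n x)) x) <= d.
  rewrite -linearBl; apply: (le_trans (cauchy_schwarz _ _)); rewrite x1 mulr1.
  by have := ler_approx_error hA_lin hA_0 happrox n x; rewrite x1 mulr1.
(* The three errors add up to at most c + d + C0 eta < delta. *)
apply: (le_lt_trans (rdist_triangle _ (inner (K x) x) _)).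
have := rdist_triangle (inner (K x) x) (inner (F (P n x)) x) (inner (F v) v).
have : a n * (2 * p n + 1) * eta <= C0 * eta by rewrite ler_wpM2r.
move: cx vF KF etaC; rewrite -/k -/c -/(a n) -/F; lra.
Qed.
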